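(* In the 1-sided False Positive regime, let the moldgraph $G$ be a planar graph with $m$ edges (with a fixed planar embedding) whose realized subgraph is a tree $T$. Consider the algorithm SolvePlanarFP: construct the dual graph $G^*$ of $G$; run SolveSparseFN on $G^*$, where a query on a dual edge is answered by querying the corresponding edge of $G$ and inverting the answer (``Yes'' becomes ``No'' and vice versa); let $F$ be the returned set of dual edges, and output $E(G)\setminus F$ (identifying dual edges with edges of $G$). Then SolvePlanarFP outputs the realized spanning tree $T$ with probability $1$ while performing $O(m)$ queries in expectation. Here SolveSparseFN$(H)$ is: if $H$ has a single vertex, return $\emptyset$; otherwise let $u$ be a vertex of minimum degree, let $N(u)$ be the collection of super-edges incident to $u$, let $e=\mathrm{DISCOVER}(N(u))$, contract $e$ to obtain $H'$, and return $\mathrm{SolveSparseFN}(H')\cup\{e\}$. DISCOVER$(\mathcal{S})$, for a collection $\mathcal{S}=\{E_1,\dots,E_k\}$ of edge sets each with a fixed cyclic order, repeats rounds; in each round, for $i=1,\dots,k$, it queries the next edge $e$ in the cyclic order of $E_i$ and returns $e$ if the (inverted) answer is ``Yes''.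
   Context: Problem (graph connectivity with noisy queries): a graph $G=(V,E)$, the moldgraph, with $n$ vertices and $m$ edges is given. An adversary selects a connected spanning subgraph of $G$ to be realized (here a spanning tree $T$). The algorithm may query an oracle on any edge $e$ (``Is $e$ realized?''), receiving ``Yes''/``No''; each query costs $1$; answers to distinct queries (including repeated queries of the same edge) are independent. In the 1-sided False Positive regime: for a realized edge the answer is always ``Yes''; for a non-realized edge the answer is ``Yes'' with a constant probability $p<1/2$ and ``No'' with probability $1-p$. The dual graph of a plane graph $G$ has one vertex per face of $G$ and, for each edge $e$ of $G$, one dual edge joining the (vertices of the) faces on the two sides of $e$; it may have parallel edges. Multigraph conventions: a super-edge is the set of all parallel edges between two vertices; $N(v)$ is the set of super-edges incident to $v$ and $\deg(v)=|N(v)|$; contracting $e=\{u,v\}$ merges $u,v$ into one vertex adjacent to all former neighbours of $u$ or $v$, deletes all edges parallel to $e$ (no self-loops), and merges super-edges that become parallel into one super-edge. *)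

(* Defs.v *)
From HB Require Import structures.
From mathcomp Require Import all_boot all_order all_algebra all_fingroup.
From mathcomp Require Import reals.
Set Implicit Arguments. Unset Strict Implicit. Unset Printing Implicit Defensive.
Import Order.TTheory GRing.Theory Num.Theory.

(* Plane graphs as rotation systems.                                        *)
(* Vertices V, edges E, each edge e has two darts (e,false),(e,true) with   *)
(* end vertices [ends e false], [ends e true].  [rot] is the rotation       *)
(* (cyclic order of darts around each vertex) of the embedding.             *)
Section PlaneGraph.
Variables (V E : finType) (ends : E -> bool -> V) (rot : {perm E * bool}).

Definition dart := (E * bool)%type.
Definition flip (d : dart) : dart := (d.1, ~~ d.2).
Definition vtx (d : dart) : V := ends d.1 d.2.

(* face traversal permutation: faces of the embedding are its orbits *)
Definition face_step (d : dart) : dart := rot (flip d).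

Definition gadj : rel V := fun x y =>
  [exists e, ((ends e false == x) && (ends e true == y))
          || ((ends e true == x) && (ends e false == y))].

Definition simple_graph : Prop :=
  (forall e, ends e false != ends e true) /\
  (forall e e', [set ends e false; ends e true] = [set ends e' false; ends e' true] -> e = e').

Definition connected_graph : Prop := forall x y, connect gadj x y.

Definition rotation_system : Prop :=
  (forall d, vtx (rot d) = vtx d) /\
  (forall d d', vtx d = vtx d' -> fconnect rot d d').

Definition num_faces : nat := fcard face_step predT.

(* genus-0 rotation system (Euler's formula V - E + F = 2 for a connected
   graph); the edgeless one-vertex graph is trivially plane. *)
Definition planar_embedding : Prop :=
  rotation_system /\ (#|E| = 0 \/ #|V| + num_faces = #|E| + 2).

Definition sub_adj (S : {set E}) : rel V := fun x y =>
  [exists e in S, ((ends e false == x) && (ends e true == y))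
               || ((ends e true == x) && (ends e false == y))].

Definition spanning_tree (T : {set E}) : Prop :=
  (forall x y, connect (sub_adj T) x y) /\
  (forall e, e \in T -> ~~ connect (sub_adj (T :\ e)) (ends e false) (ends e true)).

(* The dual multigraph G* after contracting the set F of dual edges.      *)
(* A dual vertex (face) is an orbit of face_step; the dual edge of e joins *)
(* the faces of its darts (e,false) and (e,true).  After contracting F, two *)
(* darts lie in the same (contracted) vertex iff they are related by       *)
(* same_class F.                                                           *)
Definition cstep (F : {set E}) : rel dart := fun d d' =>
  (d' == face_step d) || (d == face_step d') || ((d.1 \in F) && (d' == flip d)).

Definition same_class (F : {set E}) : rel dart := connect (cstep F).

Definition single_vertex (F : {set E}) : bool :=
  [forall d, forall d', same_class F d d'].

(* edges of the contracted graph (parallel copies of contracted edges and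
   self-loops are deleted) *)
Definition remaining (F : {set E}) (e : E) : bool :=
  ~~ same_class F (e, false) (e, true).

Definition superedge (F : {set E}) (e : E) : {set E} :=
  [set e' | remaining F e' &&
     ((same_class F (e, false) (e', false) && same_class F (e, true) (e', true))
   || (same_class F (e, false) (e', true) && same_class F (e, true) (e', false)))].

Definition incident (F : {set E}) (d : dart) (e : E) : bool :=
  remaining F e && (same_class F d (e, false) || same_class F d (e, true)).

Definition Nbr (F : {set E}) (d : dart) : {set {set E}} :=
  [set superedge F e | e in [set e | incident F d e]].

Definition deg (F : {set E}) (d : dart) : nat := #|Nbr F d|.

(* A choice function fixes, for each state (sequence of contracted edges),
   the input of DISCOVER: the super-edges of N(u) for a minimum degree
   vertex u, each listed in a fixed cyclic order (starting at its head). *)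
Definition valid_choice (choose : seq E -> seq (seq E)) : Prop :=
  forall hist : seq E, ~~ single_vertex [set x in hist] ->
  exists d : dart,
    (forall d', deg [set x in hist] d <= deg [set x in hist] d') /\
    perm_eq [seq [set x in s] | s <- choose hist] (enum (Nbr [set x in hist] d)) /\
    all uniq (choose hist).

(* j-th query of DISCOVER(L): round j / k, list number j mod k *)
Definition discover_seq (L : seq (seq E)) (j : nat) : option E :=
  let k := size L in
  let Li := nth [::] L (j %% k) in
  onth Li ((j %/ k) %% size Li).

Definition oracle (T : {set E}) (e : E) (coin : bool) : bool := (e \in T) || coin.

(* SolvePlanarFP = SolveSparseFN on G* with inverted answers.  The t-th
   query overall uses coin c t.  [run c fuel hist j t]: hist = dual edges
   contracted so far, j = number of queries made in the current DISCOVER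
   call, t = total number of queries so far; at most [fuel] further
   queries.  Returns Some hist (the set F) when the algorithm has stopped. *)
Fixpoint run (T : {set E}) (choose : seq E -> seq (seq E)) (c : nat -> bool)
    (fuel : nat) (hist : seq E) (j t : nat) : option (seq E) :=
  if single_vertex [set x in hist] then Some hist else
  match fuel with
  | 0 => None
  | fuel'.+1 =>
    match discover_seq (choose hist) j with
    | Some e =>
      if ~~ oracle T e (c t) then run T choose c fuel' (e :: hist) 0 t.+1
      else run T choose c fuel' hist j.+1 t.+1
    | None => run T choose c fuel' hist j.+1 t.+1
    end
  end.

Definition output (hist : seq E) : {set E} := [set e | e \notin hist].

End PlaneGraph.

Definition coins_of (n : nat) (w : {ffun 'I_n -> bool}) : nat -> bool :=
  fun t => if insub t is Some i then w i else false.

Definition weight (R : realType) (p : R) (n : nat) (w : {ffun 'I_n -> bool}) : R :=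
  \prod_(i < n) (if w i then p else 1 - p).

(* probability of an event depending only on the first n coins *)
Definition prob_n (R : realType) (p : R) (n : nat) (P : (nat -> bool) -> bool) : R :=
  \sum_(w : {ffun 'I_n -> bool}) weight p w * (P (coins_of w))%:R.

(* Main.v *)
Require Import Defs.
From HB Require Import structures.
From mathcomp Require Import all_boot all_order all_algebra all_fingroup.
From mathcomp Require Import reals.
From mathcomp Require Import boolp zify ring lra.
Set Implicit Arguments.
Unset Strict Implicit.
Unset Printing Implicit Defensive.
Import Order.TTheory GRing.Theory Num.Theory.

(* For an edge set S let phi S traverse the boundary of the ribbon subgraph
   (V, S): it follows face_step across the edges of S and skips the others.
   Adding one edge to S multiplies phi S by a transposition, so it merges or
   splits one orbit.  All topological facts come from counting these orbits.
   - Each edge of a spanning tree T merges two orbits of phi, so phi T has a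
     single orbit; the dual vertex is constant along it modulo ~: T, hence the
     edges outside T connect the dual graph, and by Euler's formula there are
     just enough of them to form a tree.  So every dual cut contains an edge
     outside T, and contractions of such edges stop exactly at F = ~: T.
   - A contracted dual graph has a vertex of degree at most 5.  Delete parallel
     edges from it as long as this merges two of its faces (orbits of phi X, X
     the set of deleted edges); then every face has at least three sides, and
     Euler's formula bounds the number of super-edges.
   A DISCOVER call on at most 5 lists is compared with the smallest list, of
   size s, containing an edge outside T.  This edge is queried at least once
   every 5 s queries, so the call costs 5 s / (1 - p) queries in expectation,
   while the super-edge that it contracts has at least s edges.  Summing over
   the calls gives 5 m / (1 - p). *)

(** * Counting under identifications, and orbits of permutations *)

(** Identifying the pairs of [l] one after another costs at most one value each. This bounds from
    below both the edges of a connected graph and the dual vertices left by contraction. *)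
Lemma collapse (X Y : finType) (f : X -> Y) (l : seq (X * X)) :
  exists g : X -> Y,
    [/\ forall x y, f x = f y -> g x = g y,
        forall a, a \in l -> g a.1 = g a.2
      & #|codom f| <= #|codom g| + size l].
Proof.
elim: l => [|[a b] l [g [gf gl le_fg]]]; first by exists f; split; rewrite ?addn0.
exists (fun x => if g x == g a then g b else g x); split=> [x y /gf -> //|c|].
  by rewrite inE => /predU1P[->|/gl ->] //=; rewrite eqxx if_same.
rewrite /= addnS -addSn; apply: leq_trans le_fg _; rewrite leq_add2r.
rewrite (cardD1 (g a)) codom_f add1n ltnS.
apply/subset_leq_card/subsetP=> y; rewrite !inE => /andP[ya /codomP[x yx]].
by apply/codomP; exists x; rewrite -yx (negPf ya).
Qed.

Lemma perm_iter_porbit (X : finType) (s : {perm X}) x y :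
  y \in porbit s x -> exists n, y = iter n s x.
Proof. by case/porbitP=> n ->; exists n; rewrite permX. Qed.

Lemma porbit_closed (X : finType) (s : {perm X}) (A : pred X) x :
  (forall y, A y -> A (s y)) -> A x -> forall y, y \in porbit s x -> A y.
Proof.
by move=> As Ax y /perm_iter_porbit[n ->]; elim: n => //= n; apply: As.
Qed.

Lemma porbit_step (X : finType) (s : {perm X}) x y :
  (s y \in porbit s x) = (y \in porbit s x).
Proof. by rewrite -!eq_porbit_mem; have := porbit_perm s 1 y; rewrite expg1 => ->. Qed.

(** Up to the first visit to [A], every step preserves the label. *)
Lemma first_hit (X : finType) (s : {perm X}) (Y : eqType) (lbl : X -> Y)
    (A : pred X) x a :
  (forall y, ~~ A y -> lbl (s y) = lbl y) -> a \in porbit s x -> A a ->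
  exists b, [/\ b \in porbit s x, A b & lbl b = lbl x].
Proof.
move=> lbls /perm_iter_porbit[n ->].
elim: n x => [|n IH] x /=; first by exists x; rewrite porbit_id.
have [Ax _|nAx] := boolP (A x); first by exists x; rewrite porbit_id.
rewrite -iterS iterSr => /IH[b [bx Ab lb]]; exists b; split=> //.
  by have := porbit_perm s 1 x; rewrite expg1 => <-.
by rewrite lb lbls.
Qed.

(* Going back from tperm x y * s to s must split an orbit, so x and y share
   their orbit in the product. *)
Lemma porbit_mul_tperm (X : finType) (s : {perm X}) x y z :
  x \notin porbit s y ->
  y \in porbit (tperm x y * s) x
    /\ {subset porbit s z <= porbit (tperm x y * s) z}.
Proof.
move=> nxy; set s' := (_ * s)%g.
have neq_xy : x != y by apply: contraNneq nxy => ->; rewrite porbit_id.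
have xy' : x \in porbit s' y.
  have := porbits_mul_tperm s x y; have := porbits_mul_tperm s' x y.
  rewrite /= /s' mulgA tperm2 mul1g nxy neq_xy -/s'.
  by case: (x \in _) => //=; lia.
split; first by rewrite porbit_sym.
have s'x : s' x = s y by rewrite permM tpermL.
have s'y : s' y = s x by rewrite permM tpermR.
have step w : s w \in porbit s' w.
  have [->|wx] := eqVneq w x; first by rewrite -s'y porbit_step porbit_sym.
  have [->|wy] := eqVneq w y; first by rewrite -s'x porbit_step.
  have -> : s w = s' w by rewrite permM tpermD // eq_sym.
  by rewrite porbit_step porbit_id.
apply: (@porbit_closed X s (fun w => w \in porbit s' z)); last exact: porbit_id.
move=> w wz; move: (step w).
by rewrite -!eq_porbit_mem in wz * => /eqP->.
Qed.

Lemma set_ind (X : finType) (P : {set X} -> Prop) :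
  P set0 -> (forall (A : {set X}) a, a \notin A -> P A -> P (a |: A)) -> forall A, P A.
Proof.
move=> P0 PS A; elim: {A}#|A| {-2}A (leqnn #|A|) => [|n IH] A.
  by rewrite leqn0 cards_eq0 => /eqP->.
have [->|[a aA]] := set_0Vmem A; first by [].
rewrite (cardsD1 a) aA => leAn; rewrite -(setD1K aA).
by apply: PS; rewrite ?setD11 //; apply: IH.
Qed.

Section Maps.
Variables (V E : finType) (ends : E -> bool -> V) (rot : {perm E * bool}).
Implicit Types (S X F K T : {set E}) (d : dart E).

Lemma flipK : involutive (@flip E).
Proof. by case=> e b; rewrite /flip /= negbK. Qed.

Lemma flip_neq d : flip d != d.
Proof. by case: d => e []; rewrite /flip xpair_eqE eqxx. Qed.

Lemma dart_eqflip d d' : d.1 = d'.1 -> (d' == d) || (d' == flip d).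
Proof. by case: d d' => e b [e' b'] /= ->; rewrite !xpair_eqE eqxx; case: b b' => [] []. Qed.

(** * Ribbon subgraphs of a rotation system *)

Definition twist S d := if d.1 \in S then flip d else d.

Lemma twist_inj S : injective (twist S).
Proof.
by apply: inv_inj => d; rewrite /twist; case dS: (d.1 \in S); rewrite /= dS ?flipK.
Qed.

Definition phi S : {perm E * bool} := (perm (@twist_inj S) * rot)%g.

Lemma phiE S d : phi S d = rot (if d.1 \in S then flip d else d).
Proof. by rewrite permM permE. Qed.

Lemma phi0 : phi set0 = rot.
Proof. by apply/permP=> d; rewrite phiE inE. Qed.

Lemma phiU1 S e : e \notin S ->
  phi (e |: S) = (tperm (e, false) (e, true) * phi S)%g.
Proof.
move=> eS; apply/permP=> -[e' b]; rewrite phiE [RHS]permM phiE !inE /=.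
have [->|ne] /= := eqVneq e' e.
  by case: b; rewrite ?tpermL ?tpermR /= (negPf eS).
by rewrite tpermD ?xpair_eqE /= 1?eq_sym ?(negPf ne).
Qed.

Definition norb S : nat := #|porbits (phi S)|.

(** A transposition merges two orbits or splits one; the doubled boolean records which. *)
Lemma norbU1 S e : e \notin S ->
  norb (e |: S) + ((e, false) \notin porbit (phi S) (e, true)).*2 = norb S + 1.
Proof. by move=> eS; rewrite /norb phiU1 // porbits_mul_tperm xpair_eqE andbF. Qed.

Lemma norb_ge S : norb set0 <= norb S + #|S|.
Proof.
elim/set_ind: S => [|S e eS IH]; first by rewrite leq_addr.
have := norbU1 eS; rewrite cardsU1 eS; case: (_ \notin _) => h; lia.
Qed.

Lemma flip_vtx_adj T d : d.1 \in T -> sub_adj ends T (vtx ends d) (vtx ends (flip d)).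
Proof.
by case: d => e [] /= eT; apply/existsP; exists e; rewrite /vtx /= eT !eqxx ?orbT.
Qed.

Lemma sub_adjP T x y :
  sub_adj ends T x y -> exists d, [/\ d.1 \in T, vtx ends d = x & vtx ends (flip d) = y].
Proof.
case/existsP=> e /andP[eT /orP[]/andP[/eqP <- /eqP <-]].
  by exists (e, false).
by exists (e, true).
Qed.

Lemma card_spanning T : (forall x y, connect (sub_adj ends T) x y) -> #|V| <= #|T|.+1.
Proof.
move=> conT.
have [g [_ gl]] := collapse id [seq (ends e false, ends e true) | e <- enum T].
rewrite size_map -cardE.
have -> : #|codom (@id V)| = #|V| by apply: eq_card => x; rewrite !inE; apply/codomP; exists x.
move/leq_trans; apply; rewrite -add1n leq_add2r.
apply/card_le1_eqP => _ _ /codomP[x ->] /codomP[x' ->].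
have gadj a b : sub_adj ends T a b -> g a = g b.
  case/existsP=> e /andP[eT /orP[]/andP[/eqP <- /eqP <-]];
  have := gl (ends e false, ends e true); rewrite map_f ?mem_enum // => /(_ isT) //=.
have /connectP[q] := conT x' x.
by elim: q x' => [|w q IH] x' /= => [_ ->//|/andP[/gadj -> /IH]]; apply.
Qed.

Hypothesis rotS : rotation_system ends rot.

Lemma vtx_rot d : vtx ends (rot d) = vtx ends d.
Proof. exact: rotS.1. Qed.

Lemma mem_porbit_rot d d' : (d' \in porbit rot d) = (vtx ends d' == vtx ends d).
Proof.
apply/idP/eqP => [|/esym/(rotS.2)/iter_findex <-]; last by rewrite -permX mem_porbit.
move=> h; apply/eqP; apply: (@porbit_closed _ rot (fun x => vtx ends x == vtx ends d) d) h => //.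
by move=> y; rewrite vtx_rot.
Qed.

Lemma norb0_le : norb set0 <= #|V|.
Proof.
rewrite /norb phi0.
suff sub : porbits rot \subset [set [set d | vtx ends d == v] | v : V].
  exact: leq_trans (subset_leq_card sub) (leq_imset_card _ _).
apply/subsetP=> _ /imsetP[d _ ->]; apply/imsetP; exists (vtx ends d) => //.
by apply/setP=> d'; rewrite inE mem_porbit_rot.
Qed.

Lemma phi_orbit_connected S d d' :
  d' \in porbit (phi S) d -> connect (sub_adj ends S) (vtx ends d) (vtx ends d').
Proof.
apply: (@porbit_closed _ (phi S) (fun x => connect (sub_adj ends S) (vtx ends d) (vtx ends x))) => // y.
move/connect_trans; apply; rewrite phiE vtx_rot; case: ifP => [yS|_] //.
exact/connect1/flip_vtx_adj.
Qed.

Lemma norb0_ge : (forall v, exists d, vtx ends d = v) -> #|V| <= norb set0.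
Proof.
rewrite /norb phi0 => ex_dart.
have f v : {d | vtx ends d == v} by apply: sigW; have [d <-] := ex_dart v; exists d.
have injf : injective (fun v => porbit rot (sval (f v))).
  move=> v v' /= eq_vv'; apply/eqP.
  rewrite -(eqP (svalP (f v))) -(eqP (svalP (f v'))) -mem_porbit_rot -eq_porbit_mem.
  by rewrite eq_vv'.
rewrite -(card_codom injf); apply: subset_leq_card.
by apply/subsetP=> _ /codomP[v ->]; apply: imset_f.
Qed.

(** By [phi_orbit_connected] an orbit stays in one component of the subgraph [S], and the ends of a
    new edge of [T] lie in different ones, so each edge merges two orbits. *)
Lemma norb_forest T S :
  (forall e, e \in T -> ~~ connect (sub_adj ends (T :\ e)) (ends e false) (ends e true)) ->
  S \subset T -> norb S + #|S| = norb set0.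
Proof.
move=> forT; elim/set_ind: S => [|S e eS IH]; first by rewrite cards0 addn0.
rewrite subUset sub1set => /andP[eT ST]; rewrite -(IH ST).
have nt : (e, false) \notin porbit (phi S) (e, true).
  rewrite porbit_sym; apply: contra (forT e eT) => /phi_orbit_connected.
  apply: connect_sub => x y xy; apply: connect1.
  have [d [dS <- <-]] := sub_adjP xy; apply: flip_vtx_adj.
  by rewrite !inE (subsetP ST) // andbT; apply: contraNneq eS => <-.
have := norbU1 eS; rewrite cardsU1 eS nt; lia.
Qed.

(** * Vertices of the contracted dual graph *)

Section SameClass.
Variable F : {set E}.
Notation same := (same_class rot F).

Lemma same_sym d d' : same d d' = same d' d.
Proof.
apply: sym_connect_sym => {}d {}d'; apply/idP/idP => /orP[/orP[]/eqP->|/andP[dF /eqP ->]];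
  by rewrite /cstep ?eqxx ?orbT // flipK /= dF eqxx !orbT.
Qed.

Lemma same_refl d : same d d. Proof. exact: connect0. Qed.

Lemma same_trans d1 d2 d3 : same d1 d2 -> same d2 d3 -> same d1 d3.
Proof. exact: connect_trans. Qed.

Lemma same_rot d : same (flip d) (rot d).
Proof. by apply: connect1; rewrite /cstep /face_step flipK eqxx. Qed.

Lemma same_flip d : d.1 \in F -> same d (flip d).
Proof. by move=> dF; apply: connect1; rewrite /cstep dF eqxx !orbT. Qed.

Lemma same_phi S d : [disjoint S & F] -> d.1 \notin ~: (F :|: S) -> same d (phi S d).
Proof.
move=> SF; rewrite !inE negbK phiE => /orP[dF|dS].
  rewrite (disjointFl SF) //.
  exact: same_trans (same_flip dF) (same_rot d).
by rewrite dS; have := same_rot (flip d); rewrite flipK.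
Qed.

Lemma same_phi_flip S d : d.1 \notin S -> same (flip d) (phi S d).
Proof. by move=> dS; rewrite phiE (negPf dS) same_rot. Qed.

End SameClass.

(* Euler's formula is not used: this holds in any genus. *)
Lemma tree_complement_connected T d d' :
  spanning_tree ends T -> same_class rot (~: T) d d'.
Proof.
move=> [conT forT].
have : norb T <= 1.
  have := norb_forest forT (subxx _).
  have := card_spanning conT; have := norb0_le; lia.
move/card_le1_eqP => /(_ (porbit (phi T) d) (porbit (phi T) d')).
rewrite !imset_f // => /(_ isT isT)/eqP; rewrite eq_porbit_mem.
move=> dd'; apply: (@porbit_closed _ (phi T) (fun x => same_class rot (~: T) d x) d) dd'; last exact: same_refl.
move=> y dy; apply: same_trans dy _.
by apply: same_phi; rewrite -?setI_eq0 ?setICr // setUC setUCr setCT inE.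
Qed.

(** If every edge leaving the class of [d] were in [T], no dual path through edges outside [T] could
    leave that class, although such paths reach every dart. *)
Lemma escape_edge T F d : spanning_tree ends T -> ~~ single_vertex rot F ->
  exists2 e, e \notin T & incident rot F d e.
Proof.
move=> treeT nsv; apply/exists_inP; apply: contraR nsv; rewrite negb_exists_in.
move=> /forall_inP no_esc; suff all_d d' : same_class rot F d d'.
  apply/forallP=> d1; apply/forallP=> d2; apply: same_trans (all_d d2).
  by rewrite same_sym.
have /connectP[q] := tree_complement_connected d d' treeT.
elim/last_ind: q d' => [|q d2 IH] d'; first by move=> _ ->; apply: same_refl.
rewrite rcons_path last_rcons => /andP[pq st] ->.
have {IH pq} := IH _ pq erefl; move: (last d q) st => d1 st dd1.
apply: (same_trans dd1); case/orP: st => [st|/andP[d1T /eqP ->]].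
  by apply: connect1; rewrite /cstep st.
rewrite inE in d1T; have := no_esc _ d1T; rewrite /incident /remaining.
rewrite negb_and negbK => /orP[|].
  by case: {no_esc d1T} d1 dd1 => e [] /= dd1; rewrite /flip //= same_sym.
by case: {no_esc d1T} d1 dd1 => e [] /= dd1; rewrite dd1 ?orbT.
Qed.

(** * Number of contracted dual vertices *)

Definition num_classes F : nat := n_comp (cstep rot F) predT.

Lemma face_step_inj : injective (face_step rot).
Proof. by move=> d d' /perm_inj /(inv_inj flipK). Qed.

Lemma num_faces_le F : num_faces rot <= num_classes F + #|F|.
Proof.
have [g [gf gl le_g]] := collapse (froot (face_step rot))
  [seq ((e, false), (e, true)) | e <- enum F].
have le1 : num_faces rot <= #|codom (froot (face_step rot))|.
  apply: subset_leq_card; apply/subsetP=> d; rewrite inE => /andP[/eqP <- _].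
  exact: codom_f.
rewrite size_map -cardE in le_g.
apply: leq_trans le1 (leq_trans le_g _); rewrite leq_add2r.
have gface d : g (face_step rot d) = g d.
  apply/esym/gf/fingraph.rootP; last exact: fconnect1.
  exact: fconnect_sym face_step_inj.
have gflip d : d.1 \in F -> g (flip d) = g d.
  case: d => e b /= eF; have := gl ((e, false), (e, true)).
  by rewrite map_f ?mem_enum // => /(_ isT) /=; case: b.
have gsame d d' : same_class rot F d d' -> g d = g d'.
  case/connectP=> q; elim: q d => [|d1 q IH] d /=; first by move=> _ ->.
  case/andP=> st pq e; rewrite -(IH _ pq e).
  by case/orP: st => [/orP[]/eqP->|/andP[dF /eqP->]]; rewrite ?gface ?gflip.
have sub : {subset codom g <= [seq g d | d in predI (roots (cstep rot F)) predT]}.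
  move=> _ /codomP[d ->]; rewrite (gsame d (fingraph.root (cstep rot F) d)); last exact: connect_root.
  by apply: image_f; rewrite inE andbT; apply: roots_root; apply: same_sym.
apply: leq_trans (subset_leq_card (introT subsetP sub)) _.
by apply: leq_trans (card_size _) _; rewrite size_image.
Qed.

Lemma num_classes_single F : single_vertex rot F -> num_classes F <= 1.
Proof.
move=> sv; apply/card_le1_eqP => x y; rewrite !inE => /andP[/eqP <- _] /andP[/eqP <- _].
apply/fingraph.rootP; first exact: same_sym.
by move/forallP: sv => /(_ y)/forallP/(_ x).
Qed.

(** Merging all faces into one takes at least [num_faces rot - 1] contractions, which by Euler's
    formula is at least the size of [~: T]; and [F] lies inside [~: T]. *)
Lemma single_vertex_complement T F :
  spanning_tree ends T -> #|V| + num_faces rot = #|E| + 2 ->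
  [disjoint F & T] -> single_vertex rot F -> F = ~: T.
Proof.
move=> [conT _] euler; rewrite disjoints_subset => FT sv.
apply/eqP; rewrite eqEcard FT /=.
have := num_classes_single sv; have := num_faces_le F.
have := card_spanning conT; have := cardsC T; lia.
Qed.

(** * Minimum degree of the contracted dual graph *)

Section Superedges.
Variable F : {set E}.
Notation same := (same_class rot F).

Lemma same_left d d' d2 : same d d' -> same d d2 = same d' d2.
Proof. by move=> dd'; apply: same_connect => //; apply: same_sym. Qed.

Lemma superedge_refl e : remaining rot F e -> e \in superedge rot F e.
Proof. by move=> re; rewrite inE re !same_refl. Qed.

Lemma superedge_eq e e' : e' \in superedge rot F e -> superedge rot F e' = superedge rot F e.
Proof.
rewrite inE => /andP[_ /orP[]/andP[s0 s1]]; apply/setP=> x; rewrite !inE;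
  rewrite !(same_left _ s0) !(same_left _ s1) //.
by congr (_ && _); rewrite orbC; congr (_ || _); rewrite andbC.
Qed.

Lemma remaining_notin e : remaining rot F e -> e \notin F.
Proof. by apply: contra => eF; apply: (@same_flip F (e, false)). Qed.

Definition superedges := [set superedge rot F e | e in [set e | remaining rot F e]].

Lemma Nbr_sub d : Nbr rot F d \subset superedges.
Proof.
by apply/imsetS/subsetP=> e; rewrite !inE => /andP[].
Qed.

(** Handshake: a super-edge is counted only at the classes of its two ends. *)
Lemma sum_deg_le : \sum_(d in roots (cstep rot F)) deg rot F d <= 2 * #|superedges|.
Proof.
have degE d : deg rot F d = \sum_(s in superedges) (s \in Nbr rot F d).
  rewrite -big_mkcondr /= /deg -sum1_card; apply: eq_bigl => s.
  by rewrite andbC; case: (boolP (s \in Nbr _ _ _)) => // /(subsetP (Nbr_sub d)) ->.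
under eq_bigr do rewrite degE.
rewrite exchange_big /= mulnC -sum_nat_const; apply: leq_sum => s /imsetP[e _ ->].
rewrite -big_mkcondr /= sum1_card.
pose r := fingraph.root (cstep rot F).
apply: leq_trans (_ : #|[set r (e, false); r (e, true)]| <= 2); last by rewrite cards2; case: eqP.
apply/subset_leq_card/subsetP=> d; rewrite inE => /andP[/eqP rd /imsetP[e' ie' se]].
have : e' \in superedge rot F e.
  by rewrite se superedge_refl //; move: ie'; rewrite inE => /andP[].
rewrite -rd !inE /r !root_connect //; try exact: same_sym.
move: ie'; rewrite !inE => /andP[_ /orP[]] de' /andP[_ /orP[]/andP[s0 s1]];
  rewrite -![connect _ _ _]/(same _ _) !(same_left _ de') ![same (e', _) _]same_sym ?s0 ?s1 ?orbT //.
Qed.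

Lemma card_superedges_le K :
  (forall e, remaining rot F e -> exists2 e', e' \in K & e' \in superedge rot F e) ->
  #|superedges| <= #|K|.
Proof.
move=> repK; apply: leq_trans (leq_imset_card (superedge rot F) K).
apply/subset_leq_card/subsetP=> _ /imsetP[e re ->]; rewrite inE in re.
by have [e' e'K /superedge_eq <-] := repK e re; apply: imset_f.
Qed.

(** * Faces after the deletion of parallel edges *)

Section Reduction.

Definition kept X := ~: (F :|: X).

Lemma in_kept X e : (e \in kept X) = (e \notin F) && (e \notin X).
Proof. by rewrite !inE negb_or. Qed.

(* Edges X that may be deleted from the contracted dual graph: each super-edge
   keeps a representative, and the two sides of each deleted edge lie in the
   same merged face. *)
Definition reduction X :=
  [&& [disjoint X & F],
      [forall e, remaining rot F e ==> [exists e' in kept X, e' \in superedge rot F e]]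
    & [forall d, (d.1 \in X) ==> (flip d \in porbit (phi X) d)]].

Lemma reduction0 : reduction set0.
Proof.
apply/and3P; split; first by rewrite -setI_eq0 set0I.
  apply/forallP=> e; apply/implyP=> re; apply/exists_inP; exists e.
    by rewrite in_kept remaining_notin ?inE.
  exact: superedge_refl.
by apply/forallP=> d; rewrite inE.
Qed.

Lemma reductionU1 X e : reduction X -> e \in kept X ->
  (e, false) \notin porbit (phi X) (e, true) ->
  (remaining rot F e -> exists e', [/\ e' \in kept X, e' != e & e' \in superedge rot F e]) ->
  reduction (e |: X).
Proof.
case/and3P=> XF /forallP rep /forallP flipX; rewrite in_kept => /andP[eF eX] ne par.
apply/and3P; split.
- by move: XF; rewrite !disjoints_subset subUset sub1set => ->; rewrite inE eF.
- apply/forallP=> e1; apply/implyP=> re1.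
  have /exists_inP[e' e'K e'e1] := implyP (rep e1) re1.
  apply/exists_inP; have [ee'|ne'] := eqVneq e' e; last first.
    by exists e' => //; move: e'K; rewrite !in_kept !inE (negPf ne').
  rewrite ee' in e'e1; have [|e2 [e2K ne2 e2e]] := par; first by move: e'e1; rewrite inE => /andP[].
  exists e2; first by move: e2K; rewrite !in_kept !inE (negPf ne2).
  by rewrite -(superedge_eq e'e1).
(* Adding [e] joins its two sides and only enlarges orbits, so edges deleted earlier keep both sides
   in one face. *)
have mrg d := porbit_mul_tperm d ne.
rewrite -phiU1 // in mrg.
apply/forallP=> -[e1 b]; apply/implyP; rewrite !inE /= => /predU1P[->|e1X].
  by case: b; rewrite ?[_ \in porbit _ (e, true)]porbit_sym; case: (mrg (e, false)).
by apply: (mrg _).2; apply: (implyP (flipX (e1, b))).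
Qed.

(** Consecutive kept sides of a face meet at a contracted dual vertex: the darts between them belong
    to [F] or [X], and steps of [phi X] from these preserve the class. *)
Lemma phi_next_kept X k : [disjoint X & F] -> k.1 \in kept X ->
  exists k', [/\ k' \in porbit (phi X) k, k'.1 \in kept X & same (flip k) k'].
Proof.
move=> XF kK; pose lbl := fingraph.root (cstep rot F).
have lblE d d' : same d d' <-> lbl d = lbl d'.
  by split=> [h|h]; [apply/fingraph.rootP | apply/(fingraph.rootP _)] => //; apply: same_sym.
have kO : porbit (phi X) (phi X k) = porbit (phi X) k.
  by have := porbit_perm (phi X) 1 k; rewrite expg1.
have [||//|k' [k'O k'K lk']] := @first_hit _ (phi X) _ lbl (fun d => d.1 \in kept X) (phi X k) k.
- by move=> y yK; apply/esym/lblE/same_phi.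
- by rewrite kO porbit_id.
exists k'; split=> //; first by rewrite -kO.
apply/lblE; rewrite lk'; apply/lblE/same_phi_flip.
by move: kK; rewrite in_kept => /andP[].
Qed.

(** Such an orbit is closed under [rot], so it contains all darts of a vertex, and under [flip] for
    edges outside [F]; the edges of [T] then carry it to every vertex. *)
Lemma closed_orbit_full T X d :
  (forall x y, connect (sub_adj ends T) x y) -> [disjoint F & T] -> reduction X ->
  (forall k, k \in porbit (phi X) d -> k.1 \in kept X -> flip k \in porbit (phi X) d) ->
  forall d', d' \in porbit (phi X) d.
Proof.
move=> conT FT /and3P[_ _ /forallP flipX] flipK'; set O := porbit _ d in flipK' *.
have flipO k : k.1 \notin F -> k \in O -> flip k \in O.
  move=> kF kO; have [kX|kX] := boolP (k.1 \in X).
    have := implyP (flipX k) kX; move: kO; rewrite /O.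
    by rewrite -!eq_porbit_mem => /eqP <-.
  by apply: flipK' => //; rewrite in_kept kF.
have rotO k : k \in O -> rot k \in O.
  move=> kO; have [kX|kX] := boolP (k.1 \in X).
    have : flip k \in O.
      have := implyP (flipX k) kX; move: kO; rewrite /O.
      by rewrite -!eq_porbit_mem => /eqP <-.
    by rewrite -(porbit_step (phi X)) phiE /= kX flipK.
  by move: kO; rewrite /O -(porbit_step (phi X)) phiE (negPf kX).
have vtxO k k' : k \in O -> vtx ends k' = vtx ends k -> k' \in O.
  move=> kO /eqP; rewrite -mem_porbit_rot.
  exact: (@porbit_closed _ rot (fun x => x \in O) k).
move=> d'; have /connectP[q] := conT (vtx ends d) (vtx ends d').
have : d \in O by apply: porbit_id.
elim: q {1 2 3}d => [|v q IH] d1 d1O /=; first by move=> _ h; apply: vtxO d1O _.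
case/andP=> /sub_adjP[d2 [d2T v2 <-]] pq; apply: IH => //.
apply: flipO; first by apply: contraL d2T => d2F; rewrite (disjointFr FT).
exact: vtxO d1O v2.
Qed.

(* A kept edge with one side only in the face d is, by maximality of X, the sole
   representative of its super-edge; so the face cannot be a digon.  If the face
   has both sides of all its edges, it is the only face. *)
Lemma orbit_kept_ge3 T X d :
  (forall x y, connect (sub_adj ends T) x y) -> [disjoint F & T] ->
  maxset reduction X -> 2 <= #|kept X| ->
  3 <= #|[set k in porbit (phi X) d | k.1 \in kept X]|.
Proof.
move=> conT FT /maxsetP[redX maxX] K2; set O := porbit _ d.
have XF : [disjoint X & F] by case/and3P: redX.
(* If the edge of [k] were a loop or had another kept representative, its deletion would merge two
   faces and enlarge the maximal [X]. *)
have crossing k : k.1 \in kept X -> flip k \notin porbit (phi X) k ->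
    remaining rot F k.1 /\
    forall e', e' \in kept X -> e' \in superedge rot F k.1 -> e' = k.1.
  move=> kK cross.
  have ne : (k.1, false) \notin porbit (phi X) (k.1, true).
    by case: k cross {kK} => e [] //=; rewrite porbit_sym.
  have kX : k.1 \notin X by move: kK; rewrite in_kept => /andP[].
  have nred : ~~ reduction (k.1 |: X).
    apply: contra kX => /maxX <-; [exact: setU11 | exact: subsetUr].
  split.
    by apply: contraNT nred => nr; apply: reductionU1 => // r; rewrite r in nr.
  move=> e' e'K e'k; apply/eqP; apply: contraNT nred => ne'.
  by apply: reductionU1 => // _; exists e'.
have memO k k' : k \in O -> k' \in porbit (phi X) k -> k' \in O.
  by rewrite /O -!eq_porbit_mem => /eqP <-.
have [/existsP[k /and3P[kO kK kn]]|] :=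
    boolP [exists k, [&& k \in O, k.1 \in kept X & flip k \notin O]].
  have crossk : flip k \notin porbit (phi X) k by apply: contra kn; apply: memO.
  have [rk solek] := crossing k kK crossk.
  have [k1 [k1k k1K s1]] := phi_next_kept XF kK.
  have k1O := memO _ _ kO k1k.
  have [k2 [k2k1 k2K s2]] := phi_next_kept XF k1K.
  have k2O := memO _ _ k1O k2k1.
  have nsk : ~~ same k (flip k).
    by case: k rk {kO kK kn crossk solek k1k s1} => e []; rewrite /remaining /flip //= same_sym.
  have k1nk : k1 != k.
    by apply: contraNneq nsk => k1k'; rewrite -{1}k1k' same_sym.
  have k1nf : k1 != flip k by apply: contraNneq kn => <-.
  have k1e : k1.1 != k.1.
    by apply/eqP=> e; have := dart_eqflip (esym e); rewrite (negPf k1nk) (negPf k1nf).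
  (* A digon with sides [k] and [k1] would make their edges parallel. *)
  have k2nk : k2 != k.
    apply/eqP=> k2k; rewrite k2k in s2.
    have rk1 : ~~ same k1 (flip k1).
      by apply: contra nsk => h; rewrite same_sym; apply: same_trans s1 (same_trans h s2).
    have /(solek _ k1K) h : k1.1 \in superedge rot F k.1; last by rewrite h eqxx in k1e.
    rewrite same_sym in s2; move: s1 s2 rk1; rewrite inE /remaining.
    case: (k1) (k) => [e1 b1] [e b]; rewrite /flip /=.
    by case: b1 b => [] [] /= -> ->; rewrite ?orbT ?andbT // same_sym.
  (* If [k1] is followed by itself, its edge is a loop of the contracted dual graph, so by
     [crossing] both its sides lie in this orbit and [flip k1] is a third dart. *)
  have [k21|k2n1] := eqVneq k2 k1.
    rewrite k21 in s2.
    have k1f : flip k1 \in O.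
      apply: memO k1O _; apply/negPn/negP => /(crossing _ k1K)[].
      move: s2; case: (k1) => e [] /=; rewrite /remaining /flip /= => h; rewrite ?h //.
      by rewrite same_sym h.
    apply/card_gt2P; exists k, k1, (flip k1); split; split.
    - by rewrite inE kO.
    - by rewrite inE k1O.
    - by rewrite inE k1f.
    - by rewrite eq_sym.
    - by rewrite eq_sym flip_neq.
    - by rewrite (inv_eq flipK).
  apply/card_gt2P; exists k, k1, k2; split; split=> //.
  - by rewrite inE kO.
  - by rewrite inE k1O.
  - by rewrite inE k2O.
  - by rewrite eq_sym.
  - by rewrite eq_sym.
rewrite negb_exists => /forallP ncross.
have full := @closed_orbit_full T X d conT FT redX.
have {}full : forall d', d' \in O.
  apply: full => k kO kK; apply/negPn; apply: contraL kK => kn.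
  by have := ncross k; rewrite kO kn andbT.
(* The single orbit contains both darts of each of the at least two kept edges. *)
have -> : [set k in O | k.1 \in kept X] = setX (kept X) [set: bool].
  by apply/setP=> -[e b]; rewrite !inE full andbT.
rewrite cardsX cardsT card_bool; lia.
Qed.

Lemma norb_kept X :
  (forall d, 3 <= #|[set k in porbit (phi X) d | k.1 \in kept X]|) ->
  3 * norb X <= 2 * #|kept X|.
Proof.
move=> ge3.
have <- : #|[set k : dart E | k.1 \in kept X]| = 2 * #|kept X|.
  have -> : [set k : dart E | k.1 \in kept X] = setX (kept X) [set: bool].
    by apply/setP=> -[e b]; rewrite inE in_setX in_setT andbT.
  by rewrite cardsX cardsT card_bool mulnC.
rewrite mulnC -sum_nat_const -sum1_card.
rewrite (partition_big (porbit (phi X)) (fun O => O \in porbits (phi X))) /=; last first.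
  by move=> k _; apply: imset_f.
apply: leq_sum => _ /imsetP[d _ ->]; apply: leq_trans (ge3 d) _.
rewrite -sum1_card leq_eqVlt; apply/orP; left; apply/eqP; apply: eq_bigl => k.
by rewrite !inE eq_porbit_mem andbC.
Qed.

Lemma min_degree_le5 T d :
  (forall x y, connect (sub_adj ends T) x y) -> (forall v, exists d, vtx ends d = v) ->
  #|V| + num_faces rot = #|E| + 2 -> [disjoint F & T] ->
  (forall d', deg rot F d <= deg rot F d') -> deg rot F d <= 5.
Proof.
move=> conT darts euler FT mindeg.
have [X maxX] := ex_maxset (ex_intro _ set0 reduction0).
have /maxsetP[/and3P[XF /forallP repX _] _] := maxX.
have leK : #|superedges| <= #|kept X|.
  by apply: card_superedges_le => e re; apply/exists_inP/(implyP (repX e)).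
have degK : deg rot F d <= #|kept X| := leq_trans (subset_leq_card (Nbr_sub d)) leK.
have [K2|] := leqP 2 #|kept X|; last by rewrite ltnS => K1; apply: leq_trans degK (leq_trans K1 _).
have orbK := norb_kept (fun d => orbit_kept_ge3 d conT FT maxX K2).
rewrite leqNgt; apply/negP => deg6.
have sum6 : num_classes F * 6 <= 2 * #|kept X|.
  apply: leq_trans (_ : 2 * #|superedges| <= _); last by rewrite leq_mul2l.
  apply: leq_trans sum_deg_le.
  have -> : num_classes F = #|roots (cstep rot F)| by apply: eq_card => x; rewrite !inE andbT.
  by rewrite -sum_nat_const; apply: leq_sum => d' _; apply: leq_trans deg6 (mindeg d').
have cardE : #|F| + #|X| + #|kept X| = #|E|.
  rewrite -cardsUI setIC (disjoint_setI0 XF) cards0 addn0.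
  by rewrite cardsC.
(* With [K] kept edges, Euler's formula gives [num_classes F + norb X >= K + 2], while degrees at
   least 6 give [num_classes F <= K / 3] and faces of length at least 3 give [norb X <= 2 K / 3]. *)
have := num_faces_le F; have := norb_ge X; have := norb0_ge darts; lia.
Qed.

End Reduction.

End Superedges.

End Maps.

(** * The DISCOVER calls *)

Section Discover.
Variables (V E : finType) (ends : E -> bool -> V) (rot : {perm E * bool}) (T : {set E}).
Variable choose : seq E -> seq (seq E).
Hypothesis rotS : rotation_system ends rot.
Hypothesis treeT : spanning_tree ends T.
Hypothesis darts : forall v, exists d, vtx ends d = v.
Hypothesis euler : #|V| + num_faces rot = #|E| + 2.
Hypothesis chooseP : valid_choice rot choose.

Definition num_remaining (F : {set E}) : nat := #|[set e | remaining rot F e]|.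

(** Contracting [e] turns its whole super-edge into loops, and classes only grow, so no lost edge
    returns. *)
Lemma num_remainingU1 F e : remaining rot F e ->
  num_remaining (e |: F) + #|superedge rot F e| <= num_remaining F.
Proof.
move=> re; have mono d d' : same_class rot F d d' -> same_class rot (e |: F) d d'.
  apply: connect_sub => {}d {}d' st; apply: connect1; move: st.
  by rewrite /cstep inE => /orP[->//|/andP[-> ->]]; rewrite !orbT.
have se : same_class rot (e |: F) (e, false) (e, true).
  by apply: (@same_flip _ rot _ (e, false)); rewrite !inE eqxx.
rewrite -cardsUI.
have -> : [set e' | remaining rot (e |: F) e'] :&: superedge rot F e = set0.
  apply/setP=> e'; rewrite in_setI !inE; apply/negP => /andP[/negP ns /andP[_ s]].
  apply: ns; case/orP: s => /andP[/mono s0 /mono s1].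
    by rewrite -(same_left _ s0); apply: same_trans se s1.
  rewrite -(same_left _ s1); apply: same_trans s0.
  by rewrite same_sym.
rewrite cards0 addn0; apply: subset_leq_card.
rewrite subUset; apply/andP; split; apply/subsetP=> e'; rewrite !inE.
  by apply: contra; apply: mono.
by case/andP.
Qed.

(** Here [k] is the number of lists, [s] the least size of a list with an edge outside [T], and [a]
    the position of such an edge in the query order. By minimality of [s], whichever edge is
    contracted removes at least [s] edges. *)
Lemma discover_spec (hist : seq E) :
  ~~ single_vertex rot [set x in hist] -> [disjoint [set x in hist] & T] ->
  exists k s a, [/\ k <= 5, a < k * s,
    forall j, j %% (k * s) = a ->
      exists2 e, discover_seq (choose hist) j = Some e & e \notin T
  & forall j e, discover_seq (choose hist) j = Some e -> e \notin T ->
      num_remaining [set x in e :: hist] + s <= num_remaining [set x in hist]].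
Proof.
set F := [set x in hist] => nsv FT.
have [d [mind [Lperm /allP Luniq]]] := chooseP nsv; rewrite -/F in mind Lperm.
set L := choose hist in Lperm Luniq *.
have sizeL : size L <= 5.
  rewrite -(size_map (fun s => [set x in s])) (perm_size Lperm) -cardE.
  exact: (min_degree_le5 rotS treeT.1 darts euler FT mind).
have listP s e : s \in L -> e \in s ->
    remaining rot F e /\ superedge rot F e = [set x in s].
  move=> sL es.
  have : [set x in s] \in enum (Nbr rot F d) by rewrite -(perm_mem Lperm) map_f.
  rewrite mem_enum => /imsetP[e0 _ s0].
  have e_e0 : e \in superedge rot F e0 by rewrite -s0 inE.
  rewrite s0; split; last exact: superedge_eq.
  by move: e_e0; rewrite inE => /andP[].
pose P n := has (fun s => (size s == n) && has (fun e => e \notin T) s) L.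
have exP : exists n, P n.
  have [e eT ie] := escape_edge rotS d treeT nsv.
  have : superedge rot F e \in [seq [set x in s] | s <- L].
    by rewrite (perm_mem Lperm) mem_enum imset_f // inE.
  case/mapP=> s sL se; exists (size s); apply/hasP; exists s => //.
  rewrite eqxx; apply/hasP; exists e => //.
  have : e \in superedge rot F e by apply: superedge_refl; case/andP: ie.
  by rewrite se inE.
have [_ /hasP[s sL /andP[/eqP <- /hasP[e es eT]]] mins] := ex_minnP exP.
have i_lt : index s L < size L by rewrite index_mem.
have q_lt : index e s < size s by rewrite index_mem.
have k0 : 0 < size L by apply: leq_ltn_trans i_lt.
(* With k lists, e is the query number j iff j = i + k q modulo k s, where e has
   index q in the list s of index i. *)
exists (size L), (size s), (index s L + size L * index e s); split=> //.
- apply: leq_trans (_ : size L + size L * index e s <= _); first by rewrite ltn_add2r.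
  by rewrite -mulnS leq_mul2l q_lt orbT.
- move=> j ja; exists e => //; rewrite /discover_seq.
  have -> : j = (j %/ (size L * size s) * size s + index e s) * size L + index s L.
    by rewrite {1}(divn_eq j (size L * size s)) ja; ring.
  rewrite modnMDl (modn_small i_lt) divnMDl // (divn_small i_lt) addn0 nth_index //.
  rewrite modnMDl (modn_small q_lt) onthE (nth_map e) //.
  by rewrite nth_index.
move=> j e' dj e'T.
have [s' s'L es'] : exists2 s', s' \in L & e' \in s'.
  move: dj; rewrite /discover_seq; set s' := nth _ _ _; set r := _ %% size s'.
  move=> o; exists s'; first by rewrite mem_nth // ltn_mod.
  by apply/onthP; exists r.
have [re' se'] := listP s' e' s'L es'.
rewrite set_cons; apply: leq_trans (num_remainingU1 re'); rewrite leq_add2l se'.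
rewrite cardsE (card_uniqP (Luniq _ s'L)); apply: mins; apply/hasP; exists s' => //.
by rewrite eqxx; apply/hasP; exists e'.
Qed.

(** Since [oracle] always answers Yes on [T], only edges outside [T] are contracted, whatever the
    coins. *)
Lemma run_output c n hist j t h :
  [disjoint [set x in hist] & T] -> run rot T choose c n hist j t = Some h ->
  output h = T.
Proof.
have out l : [disjoint [set x in l] & T] -> single_vertex rot [set x in l] -> output l = T.
  move=> lT /(single_vertex_complement treeT euler lT)/setP lE.
  by apply/setP=> e; have := lE e; rewrite !inE => ->; rewrite negbK.
elim: n hist j t => [|n IH] hist j t FT /=; first by case: ifP => // sv [<-]; apply: out.
case: ifP => [sv [<-]|_]; first exact: out.
case: discover_seq => [e|]; last exact: IH.
case: ifP => [|_]; last exact: IH.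
rewrite negb_or => /andP[eT _]; apply: IH.
by rewrite set_cons disjoints_subset subUset sub1set inE eT -disjoints_subset.
Qed.

End Discover.

Local Open Scope ring_scope.

(** * Expected number of queries *)

Section Coins.
Variables (R : realType) (p : R).

Definition coin_cons (b : bool) (c : nat -> bool) : nat -> bool :=
  fun t => if t is t'.+1 then c t' else b.

Definition ffun_cons n (bw : bool * {ffun 'I_n -> bool}) : {ffun 'I_n.+1 -> bool} :=
  [ffun i => oapp bw.2 bw.1 (unlift ord0 i)].

Lemma ffun_cons0 n bw : @ffun_cons n bw ord0 = bw.1.
Proof. by rewrite ffunE unlift_none. Qed.

Lemma ffun_consS n bw i : @ffun_cons n bw (lift ord0 i) = bw.2 i.
Proof. by rewrite ffunE liftK. Qed.

Lemma ffun_cons_bij n : bijective (@ffun_cons n).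
Proof.
exists (fun w : {ffun 'I_n.+1 -> bool} => (w ord0, [ffun i => w (lift ord0 i)])).
  case=> b w; rewrite ffun_cons0; congr (_, _).
  by apply/ffunP=> i; rewrite ffunE ffun_consS.
move=> w; apply/ffunP=> i.
by case: (unliftP ord0 i) => [i'|] ->; rewrite ?ffun_cons0 ?ffun_consS /= ?ffunE.
Qed.

Lemma coins_of_cons n bw : coins_of (@ffun_cons n bw) = coin_cons bw.1 (coins_of bw.2).
Proof.
apply/funext=> -[|t] /=; rewrite /coins_of.
  by rewrite insubT /= -(ffun_cons0 bw); congr (ffun_cons bw _); apply: val_inj.
case: insubP => [i lt_i ti|]; case: insubP => [i' lt_i' ti'|].
- by rewrite -ffun_consS; congr (ffun_cons bw _); apply: val_inj; rewrite /= ti /bump /= ti'.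
- by rewrite -ltnS lt_i.
- by rewrite ltnS lt_i'.
- by [].
Qed.

Lemma eq_prob_n n (P Q : (nat -> bool) -> bool) : P =1 Q -> prob_n p n P = prob_n p n Q.
Proof. by move=> PQ; apply: eq_bigr => w _; rewrite PQ. Qed.

(** Conditioning on the first coin. *)
Lemma prob_nS n (P : (nat -> bool) -> bool) :
  prob_n p n.+1 P = p * prob_n p n (fun c => P (coin_cons true c))
                    + (1 - p) * prob_n p n (fun c => P (coin_cons false c)).
Proof.
rewrite /prob_n (reindex (@ffun_cons n)) /=; last exact/onW_bij/ffun_cons_bij.
pose G b (w : {ffun 'I_n -> bool}) := weight p (ffun_cons (b, w)) * (P (coins_of (ffun_cons (b, w))))%:R.
rewrite (eq_bigr (fun bw => G bw.1 bw.2)); last by case.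
rewrite -(pair_bigA _ G) /= big_bool !mulr_sumr; congr (_ + _); apply: eq_bigr => w _;
  rewrite /G coins_of_cons /weight big_ord_recl ffun_cons0 mulrA /=; congr (_ * _ * _);
  by apply: eq_bigr => i _; rewrite ffun_consS.
Qed.

Lemma prob_n_const n b : prob_n p n (fun=> b) = b%:R.
Proof.
elim: n => [|n IH]; last by rewrite prob_nS IH; ring.
rewrite /prob_n (eq_bigr (fun=> b%:R)) => [|w _]; last by rewrite /weight big_ord0 mul1r.
by rewrite sumr_const card_ffun card_bool card_ord.
Qed.

Lemma prob_nC n (P : (nat -> bool) -> bool) :
  prob_n p n P = 1 - prob_n p n (fun c => ~~ P c).
Proof.
apply/eqP; rewrite eq_sym subr_eq -[eqbLHS]/(true%:R) -(prob_n_const n true) /prob_n -big_split /=.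
apply/eqP/eq_bigr => w _; rewrite -mulrDr; congr (_ * _).
by case: (P _); rewrite ?addr0 ?add0r.
Qed.

End Coins.

(** * Expected cost by first-step recursion *)

Section Cost.
Variables (V E : finType) (ends : E -> bool -> V) (rot : {perm E * bool}) (T : {set E}).
Variable choose : seq E -> seq (seq E).
Hypothesis rotS : rotation_system ends rot.
Hypothesis treeT : spanning_tree ends T.
Hypothesis darts : forall v, exists d, vtx ends d = v.
Hypothesis euler : (#|V| + num_faces rot = #|E| + 2)%N.
Hypothesis chooseP : valid_choice rot choose.
Variables (R : realType) (p : R).
Hypotheses (p_ge0 : 0 <= p) (p_lt1 : p < 1).

Notation stop hist := (single_vertex rot [set x in hist]).

(** Probability that more than [n] further queries are made from this state, as [prob_run] shows. *)
Fixpoint pending (n : nat) (hist : seq E) (j : nat) : R :=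
  if stop hist then 0 else
  if n is n'.+1 then
    if discover_seq (choose hist) j is Some e then
      if e \in T then pending n' hist j.+1
      else p * pending n' hist j.+1 + (1 - p) * pending n' (e :: hist) 0
    else pending n' hist j.+1
  else 1.

(** Only the coins from time [t] on are read, so the clock can be reset after each query. *)
Lemma run_ext c c' n hist j t t' : (forall i, c (t + i)%N = c' (t' + i)%N) ->
  run rot T choose c n hist j t = run rot T choose c' n hist j t'.
Proof.
elim: n hist j t t' => [|n IH] hist j t t' cc' //=; case: ifP => // _.
have shift i : c (t.+1 + i)%N = c' (t'.+1 + i)%N by rewrite !addSnnS.
have := cc' 0; rewrite !addn0 => ->.
by case: discover_seq => [e|]; [case: ifP => _|]; apply: IH.
Qed.

Lemma prob_run n hist j :
  prob_n p n (fun c => run rot T choose c n hist j 0 == None) = pending n hist j.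
Proof.
elim: n hist j => [|n IH] hist j /=.
  by case: ifP => _; rewrite prob_n_const.
rewrite prob_nS; case: ifP => _; first by rewrite !prob_n_const !mulr0 addr0.
have shift b l i : prob_n p n (fun c => run rot T choose (coin_cons b c) n l i 1 == None)
    = pending n l i.
  by rewrite -IH; apply: eq_prob_n => c; congr (_ == _); apply: run_ext.
case: discover_seq => [e|]; last by rewrite !shift; ring.
by rewrite /oracle /=; case: (e \in T) => /=; rewrite !shift //; ring.
Qed.

Lemma pending_ge0 n hist j : 0 <= pending n hist j.
Proof.
elim: n hist j => [|n IH] hist j /=; case: ifP => // _.
case: discover_seq => [e|] //; case: ifP => // _.
by rewrite addr_ge0 // mulr_ge0 // subr_ge0 ltW.
Qed.

Lemma pending_le1 n hist j : pending n hist j <= 1.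
Proof.
elim: n hist j => [|n IH] hist j /=; case: ifP => // _.
case: discover_seq => [e|] //; case: ifP => // _.
have p1 : 0 <= 1 - p by rewrite subr_ge0 ltW.
have := ler_wpM2l p_ge0 (IH hist j.+1); have := ler_wpM2l p1 (IH (e :: hist) 0%N).
rewrite !mulr1; lra.
Qed.

Lemma pending_decr n hist j : pending n.+1 hist j <= pending n hist j.
Proof.
elim: n hist j => [|n IH] hist j.
  by rewrite [leRHS]/=; case: ifP => [|_]; [rewrite /= => -> | apply: pending_le1].
rewrite [leRHS]/= [leLHS]/=; case: ifP => // _.
case: discover_seq => [e|]; last exact: IH.
case: ifP => _; first exact: IH.
by rewrite lerD // ler_wpM2l ?IH // subr_ge0 ltW.
Qed.

(** A sum of tail probabilities: the expected number of further queries, truncated at [N]. *)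
Definition cost N hist j : R := \sum_(n < N) pending n hist j.

Lemma cost_stop N hist j : stop hist -> cost N hist j = 0.
Proof. by move=> sv; apply: big1 => -[[|n] ?] _ /=; rewrite sv. Qed.

Lemma costS N hist j : ~~ stop hist -> cost N.+1 hist j = 1 +
  if discover_seq (choose hist) j is Some e then
    if e \in T then cost N hist j.+1
    else p * cost N hist j.+1 + (1 - p) * cost N (e :: hist) 0
  else cost N hist j.+1.
Proof.
move=> /negPf nsv; rewrite /cost big_ord_recl /= nsv; congr (_ + _).
case: discover_seq => [e|] //; case: ifP => // _.
by rewrite big_split /= -!mulr_sumr.
Qed.

(* The state j of a DISCOVER call is charged with the number h of queries
   before the next query of a fixed edge outside T, which recurs with period
   k * s; each time that query fails (probability p) a full period is paid. *)
Lemma cost_le N (hist : seq E) : [disjoint [set x in hist] & T] ->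
  cost N hist 0 <= 5 / (1 - p) * (num_remaining rot [set x in hist])%:R.
Proof.
set C := 5 / (1 - p); have C_ge0 : 0 <= C by rewrite divr_ge0 // subr_ge0 ltW.
move: {2}(num_remaining _ _) (leqnn (num_remaining rot [set x in hist])) => m.
elim: m N hist => [|m IHm] N hist le_m FT.
  all: have [sv|nsv] := boolP (stop hist); first by rewrite cost_stop // mulr_ge0.
  all: have [k [s [a [k5 a_lt hit drop]]]] :=
    discover_spec rotS treeT darts euler chooseP nsv FT.
  all: have s_gt0 : (0 < s)%N by case: s a_lt {hit drop} => //; rewrite muln0.
  all: have [e0 de0 e0T] := hit a (modn_small a_lt); have drop0 := drop _ _ de0 e0T.
  by have := leq_trans drop0 le_m; rewrite leqn0 addn_eq0 -[s == 0%N]leqn0 leqNgt s_gt0 andbF.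
 set rem := num_remaining _ _ in le_m drop drop0 *.
have le_s : (s <= rem)%N by apply: leq_trans drop0; apply: leq_addl.
(* [B] bounds the cost after this call, [K] is the period, and [r] is the expected number of failed
   queries of the fixed edge before a success. *)
pose B := C * (rem%:R - s%:R); pose K : R := (k * s)%:R; pose r := p / (1 - p).
have p1 : 0 < 1 - p by rewrite subr_gt0.
have B_ge0 : 0 <= B by rewrite mulr_ge0 // subr_ge0 ler_nat.
have rK_ge0 : 0 <= r * K by rewrite mulr_ge0 // divr_ge0 // ltW.
have rE : p * (1 + r) = r by rewrite /r; field; apply: lt0r_neq0.
have next N' j e : discover_seq (choose hist) j = Some e -> e \notin T ->
    cost N' (e :: hist) 0 <= B.
  move=> dj eT; have le_rem := drop j e dj eT.
  apply: le_trans (IHm _ _ _ _) _.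
    by rewrite -ltnS; apply: leq_trans (leq_trans le_rem le_m); rewrite -addn1 leq_add2l.
    by rewrite set_cons disjoints_subset subUset sub1set inE eT -disjoints_subset.
  by rewrite ler_wpM2l // lerBrDr -natrD ler_nat.
have bound N' h j : ((j + h) %% (k * s))%N = a ->
    cost N' hist j <= h%:R + 1 + r * K + B.
  elim: N' h j => [|N' IH] h j jh.
    by rewrite /cost big_ord0 !addr_ge0.
  rewrite costS //; case: h jh => [|h] jh.
    rewrite addn0 in jh; have [e dj eT] := hit j jh; rewrite dj (negPf eT).
    have := next N' j e dj eT.
    (* After a failure at [j] the fixed edge recurs at [j + k * s], which is [k * s - 1] queries
       after [j.+1]. *)
    have := IH (k * s).-1 j.+1; rewrite addSnnS prednK; last by apply: leq_ltn_trans a_lt.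
    rewrite modnDr jh => /(_ erefl); rewrite natr1 prednK; last by apply: leq_ltn_trans a_lt.
    rewrite -/K => le1 le2.
    have := ler_wpM2l p_ge0 le1; have := ler_wpM2l (ltW p1) le2.
    have -> : p * (K + r * K + B) = p * (1 + r) * K + p * B by ring.
    rewrite rE; lra.
  rewrite addnS -addSn in jh; have le1 := IH h j.+1 jh.
  rewrite -natr1; case dj: discover_seq => [e|]; last by lra.
  case: ifPn => eT; first by lra.
  have le2 := next N' j e dj eT.
  have := ler_wpM2l p_ge0 le1; have := ler_wpM2l (ltW p1) le2.
  have h_ge0 : 0 <= h%:R :> R by [].
  have := mulr_ge0 (ltW p1) (addr_ge0 (addr_ge0 h_ge0 ler01) rK_ge0).
  lra.
apply: le_trans (bound N a 0 _) _; first by rewrite add0n modn_small.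
have aK : a%:R + 1 <= K by rewrite natr1 ler_nat.
(* Since [1 + r] is [1 / (1 - p)] and [k <= 5], the call is paid by the [s] edges it removes. *)
have KC : (1 + r) * K <= C * s%:R.
  have -> : 1 + r = (1 - p)^-1 by rewrite /r; field; apply: lt0r_neq0.
  rewrite mulrC /C (mulrAC 5) /K natrM.
  apply: ler_wpM2r; first by rewrite invr_ge0 ltW.
  by apply: ler_wpM2r; rewrite ?ler_nat.
rewrite /B; lra.
Qed.

Lemma num_remaining_le F : (num_remaining rot F <= #|E|)%N.
Proof. exact: max_card. Qed.

Lemma expected_queries N :
  \sum_(n < N) prob_n p n (fun c => run rot T choose c n [::] 0 0 == None)
    <= 5 / (1 - p) * #|E|%:R.
Proof.
have -> : \sum_(n < N) prob_n p n (fun c => run rot T choose c n [::] 0 0 == None)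
    = cost N [::] 0 by apply: eq_bigr => n _; apply: prob_run.
have FT : [disjoint [set x in [::]] & T] by rewrite set_nil -setI_eq0 set0I.
apply: le_trans (cost_le N FT) _; rewrite ler_wpM2l //.
  by rewrite divr_ge0 // subr_ge0 ltW.
by rewrite ler_nat num_remaining_le.
Qed.

(** Markov's inequality: [pending] decreases in [n], so [n.+1] times the probability of still
    running after [n] queries is at most the bound on the expectation. Stopped runs are correct by
    [run_output]. *)
Lemma output_correct (eps : R) : 0 < eps ->
  exists N : nat, forall n : nat, (N <= n)%N ->
    1 - eps <= prob_n p n (fun c =>
      if run rot T choose c n [::] 0 0 is Some h then output h == T else false).
Proof.
move=> eps_gt0; set C := 5 / (1 - p) * #|E|%:R.
have [N N_gt] : exists N : nat, C / eps < N.+1%:R.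
  exists (Num.truncn (C / eps)); exact: truncnS_gt.
exists N => n le_Nn; rewrite prob_nC lerD2l lerN2.
have FT : [disjoint [set x in [::]] & T] by rewrite set_nil -setI_eq0 set0I.
rewrite (@eq_prob_n _ _ _ _ (fun c => run rot T choose c n [::] 0 0 == None)); last first.
  move=> c; case rn: run => [h|] //=.
  by rewrite (run_output treeT euler FT rn) eqxx.
rewrite prob_run.
have antitone i : (i <= n)%N -> pending n [::] 0 <= pending i [::] 0.
  move=> /subnK <-; elim: (n - i)%N => // d IH.
  by rewrite addSn; apply: le_trans (pending_decr _ _ _) IH.
have : n.+1%:R * pending n [::] 0 <= C.
  apply: le_trans (expected_queries n.+1).
  rewrite mulr_natl -[X in _ *+ X]card_ord -sumr_const; apply: ler_sum => i _.
  by rewrite prob_run; apply: antitone; rewrite -ltnS.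
rewrite ltr_pdivrMr // in N_gt.
rewrite -ler_pdivlMl // => /le_trans; apply.
rewrite ler_pdivrMl //; apply: ltW (lt_le_trans N_gt _).
by rewrite ler_pM2r // ler_nat.
Qed.

End Cost.

Theorem theorem5 (R : realType) (p : R) (hp0 : 0 < p) (hp1 : p < 1 / 2) :
  exists C : R,
  forall (V E : finType) (ends : E -> bool -> V) (rot : {perm E * bool})
         (T : {set E}) (choose : seq E -> seq (seq E)),
    simple_graph ends -> connected_graph ends ->
    planar_embedding ends rot -> spanning_tree ends T ->
    valid_choice rot choose ->
    (* expected number of queries: E[Q] = sum_n P(Q > n) <= C * m *)
    (forall N : nat,
       \sum_(n < N) prob_n p n (fun c => run rot T choose c n [::] 0 0 == None)
         <= C * (#|E|)%:R) /\
    (* the output is T with probability 1 *)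
    (forall eps : R, 0 < eps -> exists N : nat, forall n : nat, (N <= n)%N ->
       1 - eps <= prob_n p n (fun c =>
         if run rot T choose c n [::] 0 0 is Some h then output h == T else false)).
Proof.
have p_lt1 : p < 1 by lra.
exists (5 / (1 - p)) => V E ends rot T choose [noloop _] _ [rotS euler] treeT chooseP.
(* An edgeless graph has no darts, so the run stops at once; otherwise Euler's formula is
   available. *)
case: (posnP #|E|) => [E0|E_gt0].
  have noE (e : E) : False by have := fintype0 e E0.
  have runE c n : run rot T choose c n [::] 0 0 = Some [::].
    case: n => [|n] /=; rewrite (_ : single_vertex _ _ = true) //;
      by apply/forallP=> -[e].
  split=> [N|eps eps_gt0].
    rewrite big1 => [|n _]; last by under eq_prob_n do rewrite runE; rewrite prob_n_const.
    by rewrite E0 mulr0.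
  exists 0%N => n _; under eq_prob_n do rewrite runE.
  have -> : output [::] = T by apply/setP=> e; case: (noE e).
  by rewrite eqxx prob_n_const gerBl ltW.
have {}euler : (#|V| + num_faces rot = #|E| + 2)%N by case: euler => // E0; rewrite E0 in E_gt0.
(* An edge is not a loop, so a second vertex exists, and the tree path to it leaves [v] along a
   dart. *)
have darts v : exists d, vtx ends d = v.
  have [e0 _] := card_gt0P E_gt0.
  have [w vw] : exists w, w != v.
    have [e|] := eqVneq (ends e0 false) v; last by exists (ends e0 false).
    by exists (ends e0 true); rewrite -e eq_sym noloop.
  have /connectP[[|x q] /=] := treeT.1 v w; first by move=> _ e; rewrite e eqxx in vw.
  by case/andP=> /sub_adjP[d [_ vd _]] _ _; exists d.
have p_ge0 := ltW hp0.
split; first exact: (expected_queries rotS treeT darts euler chooseP p_ge0 p_lt1).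
exact: (output_correct rotS treeT darts euler chooseP p_ge0 p_lt1).
Qed.
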